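(* Let $g$ be a graph and $v$ a vertex of $g$. (1) If $v$ has degree at least $2$ in $g$, then $$g\;\sim\;\bigcup_{\{h_1,h_2\}\ \in\ \text{2-partitions of }\mathrm{link}(g,v)} (h_1\vee h_2)\wedge \mathrm{rest}(g,v).$$ (2) If $v$ has degree $1$ in $g$, then $g\sim \mathrm{rest}(g,v)$. Here graphs are identified with the sets of Cnfs living on them, $\vee$, $\wedge$ are disjunction and conjunction of sets of Cnfs, and $\sim$ is equi-satisfiability of sets of Cnfs.
   Context: Boolean formulae. Fix a countable set of variables. A literal is a variable $x$, its negation $\overline{x}$, or one of the constants $\top$ (true), $\bot$ (false). A clause is a disjunction of one or more literals, viewed as a nonempty set of literals. A Cnf is a conjunction of one or more clauses, viewed as a set of clauses. A Cnf is satisfiable if some truth assignment makes it true. Formulae are simplified by the usual rules for $\top,\bot$ (and $x\vee\overline{x}=\top$). Graphs. Vertices are the elements of a countable set; each vertex $v$ is also a boolean variable. An edge is a nonempty set of vertices, written by juxtaposition, e.g. $v_1v_2v_3$; edges may have any size ($1$: loop, $2$, $3$, ...). A graph is a nonempty multiset of edges, written $(e_1)^{n_1}\cdots(e_k)^{n_k}$ with $n_i$ the multiplicity of $e_i$. The degree of a vertex in a graph is the number of edges containing it, counted with multiplicity. Graphs as sets of Cnfs. The edge $v_1\cdots v_k$ supports the $2^k$ clauses $l_1\vee\cdots\vee l_k$ with $l_i\in\{v_i,\overline{v_i}\}$. The edge $e$ with multiplicity $n$ corresponds to the set of all Cnfs $c_1\wedge\cdots\wedge c_n$ with $c_1,\dots,c_n$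 pairwise distinct clauses supported on $e$ (this is empty if $n>2^{|e|}$). The graph $(e_1)^{n_1}\cdots(e_k)^{n_k}$ is identified with the set of all Cnfs $x_1\wedge\cdots\wedge x_k$, with $x_i$ in the set corresponding to $e_i$ with multiplicity $n_i$. If a multiset of edges such as $\mathrm{rest}(g,v)$ or a part of a partition has no edges, it is interpreted as the set of Cnfs $\{\top\}$. Satisfiability of sets. A set of Cnfs is totally satisfiable if it is nonempty and every Cnf in it is satisfiable; otherwise it is unsatisfiable. Two sets of Cnfs are equi-satisfiable, $s_1\sim s_2$, if both are totally satisfiable or both are unsatisfiable. Operations on sets of Cnfs. $s_1\wedge s_2=\{x_1\wedge x_2: x_1\in s_1,x_2\in s_2\}$; $s_1\vee s_2=\{\mathrm{cnf}(x_1\vee x_2): x_1\in s_1,x_2\in s_2\}$, where $\mathrm{cnf}(x_1\vee x_2)$ is the Cnf obtained from $x_1\vee x_2$ by distributing disjunction over conjunction. Parts of a graph. $\mathrm{rest}(g,v)$ consists of all edges of $g$ not containing $v$ (with their multiplicities). $\mathrm{link}(g,v)$ is the multiset obtained by taking every edge of $g$ containing $v$ (with multiplicity) and deleting $v$ from it; edges of size $0$ after deletion are omitted. A 2-partition of a multiset $L$ of edges is an unordered pair $\{h_1,h_2\}$ of sub-multisets of $L$ whose multiset sum is $L$ (so copies of an edge with multiplicity may be split between $h_1$ and $h_2$, and a part is allowed to be empty).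
   Formalization: Part (1) fails if v carries a loop (e.g. g=(v)^2: g is unsatisfiable, the right side is {⊤}); it is proved as stated when the edge {v} is not in g, and for loops with the empty edges left after deleting v kept in link(g,v) as the false clause. *)

(* Defs.v *)
From mathcomp Require Import all_boot finmap multiset.
From mathcomp Require Import boolp classical_sets.

Set Implicit Arguments.
Unset Strict Implicit.
Unset Printing Implicit Defensive.

Local Open Scope fset_scope.
Local Open Scope mset_scope.
Local Open Scope classical_set_scope.

Section Formulae.
Variable V : countType.

(* [inl (x, true)] is x, [inl (x, false)] is its negation, and [inr b] is the
   constant b. *)
Definition literal : countType := (V * bool + bool)%type.
Definition clause : countType := {fset literal}.
Definition cnf : countType := {fset clause}.

Definition eval_literal (a : V -> bool) (l : literal) : bool :=
  match l with inl (x, b) => a x == b | inr b => b end.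

Definition eval_clause (a : V -> bool) (c : clause) : bool :=
  has (eval_literal a) c.

Definition eval_cnf (a : V -> bool) (x : cnf) : bool :=
  all (eval_clause a) x.

Definition satisfiable (x : cnf) : Prop := exists a, eval_cnf a x.

Definition cnf_top : cnf := [fset [fset (inr true : literal)]]%fset.

Definition cnf_and (x1 x2 : cnf) : cnf := (x1 `|` x2)%fset.

(* The Cnf obtained from the disjunction by distributing it over the
   conjunctions. *)
Definition cnf_or (x1 x2 : cnf) : cnf :=
  [fset (c1 `|` c2)%fset | c1 in x1, c2 in x2]%fset.

Definition totally_satisfiable (s : set cnf) : Prop :=
  s !=set0 /\ s `<=` satisfiable.

Definition equisat (s1 s2 : set cnf) : Prop :=
  totally_satisfiable s1 <-> totally_satisfiable s2.

Definition set_and (s1 s2 : set cnf) : set cnf :=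
  [set cnf_and x1 x2 | x1 in s1 & x2 in s2].

Definition set_or (s1 s2 : set cnf) : set cnf :=
  [set cnf_or x1 x2 | x1 in s1 & x2 in s2].

End Formulae.

Section Graphs.
Variable V : countType.

Definition edge : countType := {fset V}.

Definition is_graph (g : {mset edge}) : bool :=
  (g != mset0) && (fset0 \notin g).

Definition degree (g : {mset edge}) (v : V) : nat :=
  \sum_(e <- finsupp g | v \in e) g e.

(* The function [s] chooses the sign of each vertex of [e].  The empty edge
   supports exactly one clause, the empty disjunction, which is false. *)
Definition supported (e : edge) : set (clause V) :=
  [set c | exists s : V -> bool,
             c = [fset (inl (x, s x) : literal V) | x in e]%fset].

Definition edge_cnfs (e : edge) (n : nat) : set (cnf V) :=
  [set x | #|` x| = n /\ forall c, c \in x -> supported e c].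

(* [F e] is the Cnf chosen in the set of the edge [e] with its multiplicity. *)
Definition graph_cnfs (m : {mset edge}) : set (cnf V) :=
  if m == mset0 then [set @cnf_top V]
  else [set x | exists2 F : edge -> cnf V,
                  forall e, e \in m -> edge_cnfs e (m e) (F e) &
                  x = (\bigcup_(e <- finsupp m) F e)%fset].

Definition rest (g : {mset edge}) (v : V) : {mset edge} :=
  seq_mset ([seq e <- g | v \notin e] : seq edge).

(* Keeps the empty edge produced by a loop at [v]; [link] drops it.  The two
   coincide when [v] carries no loop. *)
Definition punctured_star (g : {mset edge}) (v : V) : {mset edge} :=
  seq_mset ([seq (e `\ v)%fset | e <- g & v \in e] : seq edge).

Definition link (g : {mset edge}) (v : V) : {mset edge} :=
  seq_mset ([seq e <- punctured_star g v | e != fset0] : seq edge).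

(* Ordered pairs represent unordered ones: since [cnf_or] is commutative, a
   union of [set_or (graph_cnfs h.1) (graph_cnfs h.2)] is the same for both. *)
Definition two_partitions (L : {mset edge}) : set ({mset edge} * {mset edge}) :=
  [set h | (h.1 `+` h.2)%mset = L].

End Graphs.

(* Main.v *)
Require Import Defs.
From mathcomp Require Import all_boot finmap multiset.
From mathcomp Require Import boolp classical_sets.

Set Implicit Arguments.
Unset Strict Implicit.
Unset Printing Implicit Defensive.

Local Open Scope mset_scope.
Local Open Scope classical_set_scope.

(** The theorem is the resolution step that eliminates a variable, carried out
for all the Cnfs on a graph at once.

A Cnf [x] on [g] falls into three groups of clauses: those containing [v],
those containing the negation of [v], and those without [v].  Deleting the
literal of [v] from the first two groups gives [x1] and [x2], and [x] reads
[(v \/ x1) /\ (~ v \/ x2) /\ y].  Hence [x] is satisfiable exactly when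
[(x1 \/ x2) /\ y] is: a model of [x] makes one of [v], [~ v] false, hence the
matching [x1] or [x2] true; conversely [v] occurs in none of [x1], [x2], [y], so
a model of [(x1 \/ x2) /\ y] can be changed at [v] to serve the other half.

What remains is that the triples [(x1, x2, y)] obtained from the Cnfs on [g] are
exactly those that occur in the union over the 2-partitions.  The edges of [x1]
and [x2] together form the punctured star of [v], each with its multiplicity,
because an edge [e] at [v] of multiplicity [n] carries [n] distinct clauses and
deleting [v] with a fixed sign is injective
([split_realizes_split]); conversely, putting the literals back yields a Cnf on
[g] which splits into the given triple ([split_realizes_glue]).  The
correspondence handles nonemptiness of the two sets of Cnfs and satisfiability
of their members together ([eliminate_vertex]).

The argument covers loops, since the punctured star keeps the empty edge that
a loop leaves behind; without a loop at [v] the punctured star is the link.  It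
also covers degree 1: the star is then a single edge, so one of [x1], [x2]
is the empty conjunction and [x1 \/ x2] is true. *)

(** * Clauses supported on an edge *)

Section SignedClauses.
Variable V : countType.
Implicit Types (c : clause V) (x y : cnf V) (e : edge V) (m g : {mset edge V}).
Implicit Types (v : V) (b : bool).

Definition lit v b : literal V := inl (v, b).

Definition signed (s : V -> bool) e : clause V :=
  [fset (inl (u, s u) : literal V) | u in e]%fset.

Definition vars c : edge V :=
  seq_fset tt (pmap (fun l : literal V =>
                       if l is inl p then Some p.1 else None) (enum_fset c)).

Lemma in_vars c v :
  (v \in vars c) = (lit v true \in c) || (lit v false \in c).
Proof.
rewrite seq_fsetE mem_pmap; apply/mapP/orP.
  by move=> [] [[u []]|b] //= uc [->]; [left|right].
by case=> vc; [exists (lit v true)|exists (lit v false)].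
Qed.

Lemma lit_signed s e v b : (lit v b \in signed s e) = (v \in e) && (s v == b).
Proof.
apply/imfsetP/andP => /= [[u ue [-> ->]]|[ve /eqP <-]]; first by rewrite eqxx.
by exists v.
Qed.

Lemma const_signed s e b : ((inr b : literal V) \in signed s e) = false.
Proof. by apply/imfsetP => -[]. Qed.

Lemma vars_signed s e : vars (signed s e) = e.
Proof.
apply/fsetP => v; rewrite in_vars !lit_signed.
by case: (s v); rewrite ?andbT ?andbF ?orbF.
Qed.

Lemma supportedP e c : supported e c -> vars c = e.
Proof. by case=> s ->; exact: vars_signed. Qed.

Lemma signed_del s e v :
  (signed s e `\ lit v (s v))%fset = signed s (e `\ v)%fset.
Proof.
apply/fsetP => -[[u b]|b]; rewrite !inE ?const_signed ?andbF //.
rewrite -!/(lit _ _) !lit_signed !inE.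
case: (eqVneq u v) => [->|uv] /=.
  case: (eqVneq (s v) b) => [->|]; last by rewrite !andbF.
  by rewrite eqxx.
suff -> : lit u b != lit v (s v) by [].
by apply: contra uv => /eqP[->].
Qed.

Lemma signed_add s e v b : v \notin e ->
  (lit v b |` signed s e)%fset
  = signed (fun u => if u == v then b else s u) (v |` e)%fset.
Proof.
move=> ve; apply/fsetP => -[[u d]|d]; rewrite !inE ?const_signed //.
rewrite -!/(lit _ _) !lit_signed !inE.
case: (eqVneq u v) => [->|uv] /=.
  rewrite (negbTE ve) orbF eq_sym.
  by apply/eqP/eqP => [[]|->].
suff /negbTE -> : lit u d != lit v b by [].
by apply: contra uv => /eqP[->].
Qed.

(** * Evaluation *)

Lemma eval_clauseP a c :
  reflect (exists2 l, l \in c & @eval_literal V a l) (eval_clause a c).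
Proof. exact: hasP. Qed.

Lemma eval_cnfP a x :
  reflect (forall c, c \in x -> eval_clause a c) (eval_cnf a x).
Proof. exact: allP. Qed.

Lemma eval_cnf0 a : eval_cnf a (fset0 : cnf V).
Proof. by apply/eval_cnfP => c; rewrite inE. Qed.

Lemma eval_cnf_top a : eval_cnf a (cnf_top V).
Proof.
apply/eval_cnfP => c; rewrite inE => /eqP ->; apply/eval_clauseP.
by exists (inr true); rewrite ?inE.
Qed.

Lemma eval_cnf_and a x y :
  eval_cnf a (cnf_and x y) = eval_cnf a x && eval_cnf a y.
Proof.
apply/eval_cnfP/andP => [h|[/eval_cnfP hx /eval_cnfP hy] c].
  by split; apply/eval_cnfP => c cx; apply: h; rewrite inE cx ?orbT.
by rewrite inE => /orP[/hx|/hy].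
Qed.

Lemma eval_clauseU a c d :
  eval_clause a (c `|` d)%fset = eval_clause a c || eval_clause a d.
Proof.
apply/eval_clauseP/orP => [[l]|].
  by rewrite inE => /orP[] lc al; [left|right]; apply/eval_clauseP; exists l.
by case=> /eval_clauseP[l lc al]; exists l; rewrite // inE lc ?orbT.
Qed.

Lemma eval_clause1 a l : eval_clause a [fset l]%fset = @eval_literal V a l.
Proof.
apply/eval_clauseP/idP => [[k]|al]; first by rewrite inE => /eqP ->.
by exists l; rewrite ?inE.
Qed.

(** Distributing a disjunction over two conjunctions preserves its truth value,
also when one of the conjunctions is empty: the result is then empty too. *)
Lemma eval_cnf_or a x y :
  eval_cnf a (cnf_or x y) = eval_cnf a x || eval_cnf a y.
Proof.
apply/eval_cnfP/orP => [h|h _ /imfset2P[c /= cx [d /= dy ->]]].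
  case: (boolP (eval_cnf a x)) => [|/allPn[c cx nc]]; [by left|right].
  apply/eval_cnfP => d dy.
  have := h (c `|` d)%fset; rewrite eval_clauseU (negbTE nc); apply.
  by apply/imfset2P; exists c => //; exists d.
rewrite eval_clauseU.
by case: h => /eval_cnfP h; [rewrite (h c cx)|rewrite (h d dy) orbT].
Qed.

(** * Cnfs with a prescribed multiset of edges *)

(** Each clause lies on an edge, which can only be the set of its variables; so
the edge need not be recorded along with the clause. *)
Definition signed_cnf x := forall c, c \in x -> supported (vars c) c.

Lemma signed_cnfP x c : signed_cnf x -> c \in x -> exists s e, c = signed s e.
Proof. by move=> wx /wx[s cE]; exists s, (vars c). Qed.

Lemma signed_cnfI x :
  (forall c, c \in x -> exists s e, c = signed s e) -> signed_cnf x.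
Proof. by move=> h c /h[s [e ->]]; rewrite vars_signed; exists s. Qed.

Definition scope x : {mset edge V} := seq_mset [seq vars c | c <- enum_fset x].

Lemma scopeE x e : scope x e = \sum_(c <- x) (vars c == e).
Proof.
rewrite mset_seqE count_map -sum1_count big_mkcond.
by apply: eq_bigr => c _ /=; case: eqP.
Qed.

Lemma scope_card x e : scope x e = #|` [fset c in x | vars c == e]%fset|.
Proof.
rewrite scopeE card_fset_sum1 -big_fset_condE [RHS]big_mkcond.
by apply: eq_bigr => c _; case: eqP.
Qed.

(** The Cnfs on the graph [m], described through their clauses instead of
through a choice of one Cnf per edge.  Unlike [graph_cnfs], this gives the empty
conjunction on the empty graph, which thus needs no separate treatment. *)
Definition realizes m x := signed_cnf x /\ scope x = m.

Lemma realizes_card m x e :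
  realizes m x -> #|` [fset c in x | vars c == e]%fset| = m e.
Proof. by move=> [_ <-]; rewrite scope_card. Qed.

Lemma scope_gt0 x c : c \in x -> 0 < scope x (vars c).
Proof.
move=> cx; rewrite scope_card cardfs_gt0.
by apply/fset0Pn; exists c; rewrite !inE /= cx eqxx.
Qed.

Lemma realizes_mem m x c : realizes m x -> c \in x -> vars c \in m.
Proof. by move=> [_ <-] /scope_gt0; rewrite mset_gt0. Qed.

Lemma realizes0 x : realizes mset0 x <-> x = fset0.
Proof.
split=> [rx|->].
  by apply/eqP/fset0Pn => -[c /(realizes_mem rx)]; rewrite in_mset0.
split=> [c|]; first by rewrite inE.
by apply/msetP => e; rewrite scopeE big_nil mset0E.
Qed.

(** Clauses on different edges are different, so the Cnf chosen for the edge [e]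
can be read off the whole Cnf as the set of its clauses with variables [e]. *)
Lemma graph_cnfsE m x :
  m != mset0 -> graph_cnfs m x <-> realizes m x.
Proof.
rewrite /graph_cnfs => /negbTE -> /=; split => [[F hF ->]|rx]; last first.
  exists (fun e => [fset c in x | vars c == e]%fset) => [e em|].
    split=> [|c]; first exact: realizes_card.
    by rewrite !inE /= => /andP[cx /eqP <-]; apply: rx.1.
  apply/fsetP => c; apply/idP/bigfcupP => [cx|[e _]]; last first.
    by rewrite !inE /= => /andP[].
  exists (vars c); last by rewrite !inE /= cx eqxx.
  by rewrite msuppE (realizes_mem rx cx).
have FE e c : e \in m -> c \in F e -> supported e c.
  by move=> em; case: (hF e em) => _; apply.
split=> [c /bigfcupP[e]|].
  rewrite andbT msuppE => em cF; have ec := FE e c em cF.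
  by rewrite (supportedP ec).
apply/msetP => e; rewrite scope_card.
have [em|em] := boolP (e \in m).
  rewrite -(hF e em).1; congr #|` _|; apply/fsetP => c; rewrite !inE /=.
  apply/andP/idP => [[/bigfcupP[d]]|cF].
    rewrite andbT msuppE => dm cF; rewrite (supportedP (FE _ _ dm cF)).
    by move=> /eqP <-.
  rewrite (supportedP (FE _ _ em cF)); split=> //.
  by apply/bigfcupP; exists e; rewrite // andbT msuppE.
rewrite (mset_eq0P em); apply/eqP; rewrite cardfs_eq0.
apply/fset0Pn => -[c]; rewrite !inE /= => /andP[/bigfcupP[d]].
rewrite andbT msuppE => dm cF; rewrite (supportedP (FE _ _ dm cF)) => /eqP de.
by rewrite -de dm in em.
Qed.

(** The two descriptions differ only on the empty graph, where they give the
true constant and the empty conjunction; both hold under all assignments. *)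
Lemma realize_graph_cnf m x : graph_cnfs m x ->
  exists2 y, realizes m y & forall a, eval_cnf a x = eval_cnf a y.
Proof.
have [->|m0] := eqVneq m mset0; last by move/(graph_cnfsE _ m0); exists x.
rewrite /graph_cnfs eqxx => ->; exists fset0; first exact/realizes0.
by move=> a; rewrite eval_cnf0 eval_cnf_top.
Qed.

Lemma graph_cnf_realize m y : realizes m y ->
  exists2 x, graph_cnfs m x & forall a, eval_cnf a x = eval_cnf a y.
Proof.
have [->|m0] := eqVneq m mset0; last by move/(graph_cnfsE _ m0); exists y.
move/realizes0 ->; exists (cnf_top V); first by rewrite /graph_cnfs eqxx.
by move=> a; rewrite eval_cnf0 eval_cnf_top.
Qed.

(** * The star and the rest of a vertex *)

Lemma punctured_starE g v e :
  punctured_star g v e = if v \in e then 0 else g (v |` e)%fset.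
Proof.
rewrite mset_seqE count_map count_filter.
case: ifP => ve.
  apply/eqP; rewrite -leqn0 leqNgt -has_count; apply/hasPn => f _ /=.
  by apply/negP => /andP[/eqP fe]; move: ve; rewrite -fe !inE eqxx.
rewrite -count_mem_mset; apply: eq_count => f /=.
apply/andP/eqP => [[/eqP <- vf]|->]; first by rewrite fsetD1K.
by rewrite fsetU1K ?ve // !inE !eqxx.
Qed.

Lemma restE g v e :
  rest g v e = if v \in e then 0 else g e.
Proof.
rewrite mset_seqE count_filter.
case: ifP => ve.
  apply/eqP; rewrite -leqn0 leqNgt -has_count; apply/hasPn => f _ /=.
  by apply/negP => /andP[/eqP ->]; rewrite ve.
rewrite -count_mem_mset; apply: eq_count => f /=.
by case: eqP => [->|//]; rewrite ve.
Qed.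

Lemma link_no_loop g v :
  [fset v]%fset \notin g -> link g v = punctured_star g v.
Proof.
move=> vg; rewrite /link -[RHS]seq_mset_id; congr seq_mset.
apply/all_filterP/allP => e.
rewrite /= -mset_gt0 punctured_starE; case: ifP => // _.
rewrite mset_gt0; apply: contraTneq => ->.
by rewrite fsetU0.
Qed.

Lemma mset_rest_star g g' v :
  rest g v = rest g' v -> punctured_star g v = punctured_star g' v -> g = g'.
Proof.
move=> hr hs; apply/msetP => e; have [ve|ve] := boolP (v \in e).
  have := congr1 (fun m : {mset edge V} => m (e `\ v)%fset) hs.
  by rewrite !punctured_starE !inE eqxx /= fsetD1K.
have := congr1 (fun m : {mset edge V} => m e) hr.
by rewrite !restE (negbTE ve).
Qed.

(** * Splitting a Cnf at a vertex *)

Definition residual v b x : cnf V :=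
  [fset (c `\ lit v b)%fset | c in [fset c in x | lit v b \in c]]%fset.

Definition free v x : cnf V := [fset c in x | v \notin vars c]%fset.

Lemma in_free v x c : (c \in free v x) = (c \in x) && (v \notin vars c).
Proof. by rewrite !inE. Qed.

Lemma residualP v b x c :
  reflect (exists2 d, d \in x & lit v b \in d /\ c = (d `\ lit v b)%fset)
          (c \in residual v b x).
Proof.
apply: (iffP (imfsetP _ _ _ _)) => /= -[d].
  by rewrite !inE /= => /andP[dx vd] ->; exists d.
by move=> dx [vd ->]; exists d; rewrite // !inE /= dx.
Qed.

Lemma signed_cnf_residual v b x :
  signed_cnf x -> signed_cnf (residual v b x).
Proof.
move=> wx; apply: signed_cnfI => c /residualP[d /(signed_cnfP wx)[s [e ->]]].
rewrite lit_signed => -[/andP[ve /eqP <-] ->].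
by exists s, (e `\ v)%fset; rewrite signed_del.
Qed.

Lemma signed_cnf_free v x : signed_cnf x -> signed_cnf (free v x).
Proof. by move=> wx c; rewrite in_free => /andP[/wx]. Qed.

Lemma residual_fresh v b x c :
  signed_cnf x -> c \in residual v b x -> v \notin vars c.
Proof.
move=> wx /residualP[d /(signed_cnfP wx)[s [e ->]]].
rewrite lit_signed => -[/andP[ve /eqP <-] ->].
by rewrite signed_del vars_signed !inE eqxx.
Qed.

Lemma scope_free v x : scope (free v x) = rest (scope x) v.
Proof.
apply/msetP => e; rewrite restE !scopeE -big_fset_condE big_mkcond.
case: ifP => ve; [apply: big1|apply: eq_bigr] => c _.
  by case: ifP => // vc; case: eqP => // ce; rewrite ce ve in vc.
by case: ifP => // vc; case: eqP => // ce; rewrite ce ve in vc.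
Qed.

(** Deleting one fixed literal from clauses that contain it is injective, so no
two clauses of [x] are merged and multiplicities can be counted in [x]. *)
Lemma scope_residual v b x e :
  scope (residual v b x) e
  = \sum_(c <- x) (lit v b \in c) && (vars (c `\ lit v b)%fset == e).
Proof.
rewrite scopeE big_imfset /=; last first.
  move=> c d; rewrite !inE /= => /andP[_ vc] /andP[_ vd] cd.
  by rewrite -(fsetD1K vc) cd fsetD1K.
rewrite -big_fset_condE big_mkcond; apply: eq_bigr => c _.
by case: ifP.
Qed.

(** A clause at [v] contains exactly one of the two literals of [v], so it is
counted in exactly one of the two residuals. *)
Lemma scope_residuals v x : signed_cnf x ->
  (scope (residual v true x) `+` scope (residual v false x))%mset
  = punctured_star (scope x) v.
Proof.
move=> wx; apply/msetP => e.
rewrite msetE2 punctured_starE !scope_residual -big_split /=.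
rewrite (_ : (if _ then _ else _) =
  \sum_(c <- x) (v \notin e) && (vars c == v |` e)%fset); last first.
  by case: ifP => ve; rewrite ?scopeE // big1.
apply: eq_big_seq => c /(signed_cnfP wx)[s [f ->]].
rewrite !lit_signed vars_signed.
have [vf|vf] /= := boolP (v \in f); last first.
  rewrite addn0; case: eqP => [fe|]; last by rewrite andbF.
  by rewrite fe !inE eqxx in vf.
transitivity (nat_of_bool (f `\ v == e)%fset).
  rewrite -(vars_signed s (f `\ v)%fset) -signed_del.
  by case: (s v); rewrite /= ?addn0.
congr nat_of_bool; apply/eqP/andP => [<-|[ve /eqP ->]].
  by rewrite !inE eqxx fsetD1K.
by rewrite fsetU1K.
Qed.

(** Clauses containing the literal of [v] that [a] makes true hold
under [a]; those containing the other literal hold when their remainder does. *)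
Lemma eval_cnf_split v a x : signed_cnf x ->
  eval_cnf a x = eval_cnf a (residual v (~~ a v) x) && eval_cnf a (free v x).
Proof.
move=> wx.
have litF c : lit v (~~ a v) \in c ->
    eval_clause a c = eval_clause a (c `\ lit v (~~ a v))%fset.
  move=> vc; rewrite -[in LHS](fsetD1K vc) eval_clauseU eval_clause1 /=.
  by case: (a v).
apply/eval_cnfP/andP => [h|[/eval_cnfP hr /eval_cnfP hf] c cx].
  split; apply/eval_cnfP => c; last by rewrite in_free => /andP[/h].
  by move=> /residualP[d dx [vd ->]]; rewrite -litF // h.
have [vc|vc] := boolP (v \in vars c); last by apply: hf; rewrite in_free cx.
have [nc|] := boolP (lit v (~~ a v) \in c).
  by rewrite litF //; apply: hr; apply/residualP; exists c.
move: vc; have [s [e ->]] := signed_cnfP wx cx.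
rewrite vars_signed lit_signed => ve; rewrite ve /= => nsv; apply/eval_clauseP.
exists (lit v (a v)); last by rewrite /= eqxx.
by rewrite lit_signed ve; case: (s v) nsv; case: (a v).
Qed.

Definition fresh v x := forall c, c \in x -> v \notin vars c.

Definition assign (a : V -> bool) v b u := if u == v then b else a u.

Lemma eval_assign v b a x : signed_cnf x -> fresh v x ->
  eval_cnf (assign a v b) x = eval_cnf a x.
Proof.
move=> wx fx; apply: eq_in_all => c cx; apply: eq_in_has => -[[u d]|//] /= uc.
suff /negbTE uv : u != v by rewrite /assign uv.
apply: contraNneq (fx _ cx) => <-; rewrite in_vars.
by case: d uc => ->; rewrite ?orbT.
Qed.

(** * Gluing a split Cnf back together *)

Definition glue v (X : bool -> cnf V) y : cnf V :=
  ([fset (lit v true |` c)%fset | c in X true] `|`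
   [fset (lit v false |` c)%fset | c in X false] `|` y)%fset.

Lemma glueP v X y c :
  reflect ((exists b d, d \in X b /\ c = (lit v b |` d)%fset) \/ c \in y)
          (c \in glue v X y).
Proof.
rewrite /glue !inE; apply: (iffP orP) => -[]; try by right.
  by case/orP => /imfsetP[d /= dX ->]; left; [exists true, d|exists false, d].
case=> -[] [d [dX ->]]; left; apply/orP; [left|right].
  by apply/imfsetP; exists d.
by apply/imfsetP; exists d.
Qed.

Section Glue.
Variables (v : V) (X : bool -> cnf V) (y : cnf V).
Hypotheses (wX : forall b, signed_cnf (X b)) (wy : signed_cnf y).
Hypotheses (fX : forall b, fresh v (X b)) (fy : fresh v y).

Lemma signed_cnf_glue : signed_cnf (glue v X y).
Proof.
apply: signed_cnfI => c /glueP[[b [d [dX ->]]]|]; last exact: signed_cnfP.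
have := fX dX; have [s [e ->]] := signed_cnfP (wX (b := b)) dX.
rewrite vars_signed => /signed_add ->.
by exists (fun u => if u == v then b else s u), (v |` e)%fset.
Qed.

Lemma fresh_lit x b c : fresh v x -> c \in x -> lit v b \notin c.
Proof.
by move=> fx /fx; rewrite in_vars negb_or => /andP[]; case: b.
Qed.

Lemma residual_glue b : residual v b (glue v X y) = X b.
Proof.
apply/fsetP => c; apply/residualP/idP => [[d /glueP[[b' [c' [c'X ->]]]|dy]]|cX].
- have nc := fresh_lit _ (fX (b := b')) c'X.
  rewrite !inE (negbTE (nc b)) orbF => -[/eqP[->]] ->.
  by rewrite (fsetU1K (nc b')).
- by case=> vd; have := fresh_lit b fy dy; rewrite vd.
exists (lit v b |` c)%fset; first by apply/glueP; left; exists b, c.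
by rewrite !inE eqxx (fsetU1K (fresh_lit b (fX (b := b)) cX)).
Qed.

Lemma free_glue : free v (glue v X y) = y.
Proof.
apply/fsetP => c; rewrite in_free; apply/andP/idP => [[]|cy]; last first.
  by split; [apply/glueP; right|exact: fy].
case/glueP => // -[b [d [_ ->]]].
by rewrite in_vars; case: b; rewrite !inE eqxx ?orbT.
Qed.

End Glue.

(** * Eliminating a vertex *)

(** [X true] and [X false] play the two parts of a 2-partition of [L].  The
parts themselves are not quantified over: each is the scope of its Cnf. *)
Definition split_realizes L r (X : bool -> cnf V) y :=
  [/\ forall b, signed_cnf (X b), realizes r y
    & (scope (X true) `+` scope (X false))%mset = L].

Lemma split_realizes_split g v x : realizes g x ->
  split_realizes (punctured_star g v) (rest g v)
    (fun b => residual v b x) (free v x).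
Proof.
move=> [wx <-]; split=> [b||]; first exact: signed_cnf_residual.
  by split; [exact: signed_cnf_free|exact: scope_free].
exact: scope_residuals.
Qed.

(** No edge of the punctured star of [v] or of the rest contains [v], so the
literals of [v] that gluing adds are new, and splitting removes just these.  The
glued Cnf is on [g] because the rest and the star of a vertex determine the
graph. *)
Lemma split_realizes_glue g v X y :
  split_realizes (punctured_star g v) (rest g v) X y ->
  [/\ realizes g (glue v X y), forall b, residual v b (glue v X y) = X b
    & free v (glue v X y) = y].
Proof.
move=> [wX [wy sy] sX].
have fX b : fresh v (X b).
  move=> c cX; apply/negP => vc; have := scope_gt0 cX.
  have := congr1 (fun m : {mset edge V} => m (vars c)) sX.
  rewrite /= msetE2 punctured_starE vc => /eqP.
  by rewrite addn_eq0 => /andP[/eqP s1 /eqP s2]; case: b {cX}; rewrite ?s1 ?s2.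
have fy : fresh v y.
  move=> c cy; apply/negP => vc.
  have := realizes_mem (conj wy sy) cy.
  by rewrite -mset_gt0 restE vc.
have w := signed_cnf_glue wX wy fX.
have R := residual_glue fX fy; have F := free_glue X fy.
split=> [||//]; last by move=> b; exact: R.
split=> //; apply: (mset_rest_star (v := v)); first by rewrite -scope_free F.
by rewrite -scope_residuals // !R.
Qed.

Lemma totally_satisfiable_realizes g :
  totally_satisfiable (graph_cnfs g) <->
  (exists x, realizes g x) /\ forall x, realizes g x -> satisfiable x.
Proof.
split=> -[[x gx] sat]; split.
- by have [y ry _] := realize_graph_cnf gx; exists y.
- by move=> y /graph_cnf_realize[z /sat[a az] zy]; exists a; rewrite -zy.
- by have [z gz _] := graph_cnf_realize gx; exists z.
- by move=> z /realize_graph_cnf[y /sat[a ay] zy]; exists a; rewrite zy.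
Qed.

(** Total satisfiability of the union over the 2-partitions of [L], in terms of
the underlying Cnfs. *)
Definition split_satisfiable L r :=
  (exists X y, split_realizes L r X y) /\
  forall X y, split_realizes L r X y ->
    exists a, (eval_cnf a (X true) || eval_cnf a (X false)) && eval_cnf a y.

(** The correspondence between Cnfs on [g] and split Cnfs transports
both nonemptiness and satisfiability. *)
Lemma eliminate_vertex g v :
  totally_satisfiable (graph_cnfs g) <->
  split_satisfiable (punctured_star g v) (rest g v).
Proof.
rewrite totally_satisfiable_realizes; split=> [[[x gx] sat]|[[X [y sXy]] sat]].
  split=> [|X y /split_realizes_glue[rg R F]].
    exists (fun b => residual v b x), (free v x).
    exact: split_realizes_split.
  have [a sat_a] := sat _ rg; exists a; move: sat_a.
  rewrite (eval_cnf_split v _ rg.1) R F => /andP[+ ->].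
  by rewrite andbT; case: (~~ a v) => ->; rewrite ?orbT.
split=> [|x rx].
  by have [rg _ _] := split_realizes_glue sXy; exists (glue v X y).
have [a /andP[aX ay]] := sat _ _ (split_realizes_split v rx).
(* The residual of sign [b] holds under [a], so [v] can be set to satisfy the
   clauses that contain the literal of the other sign. *)
have [b ab] : exists b, eval_cnf a (residual v b x).
  by case/orP: aX => ?; [exists true|exists false].
have wx := rx.1; exists (assign a v (~~ b)); rewrite (eval_cnf_split v _ wx).
rewrite {2}/assign eqxx negbK !eval_assign ?ab ?ay //.
- exact: signed_cnf_free.
- by move=> c; rewrite in_free => /andP[].
- exact: signed_cnf_residual.
- by move=> c; exact: residual_fresh.
Qed.

Lemma totally_satisfiable_partitions L r :
  totally_satisfiable
    (\bigcup_(h in two_partitions L)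
       set_and (set_or (graph_cnfs h.1) (graph_cnfs h.2)) (graph_cnfs r)) <->
  split_satisfiable L r.
Proof.
have lift X y : split_realizes L r X y -> exists2 z,
    (\bigcup_(h in two_partitions L)
       set_and (set_or (graph_cnfs h.1) (graph_cnfs h.2)) (graph_cnfs r)) z &
    forall a, eval_cnf a z
              = (eval_cnf a (X true) || eval_cnf a (X false)) && eval_cnf a y.
  move=> [wX ry sX].
  have [x1 g1 e1] := graph_cnf_realize (conj (wX true) erefl).
  have [x2 g2 e2] := graph_cnf_realize (conj (wX false) erefl).
  have [z gz ez] := graph_cnf_realize ry.
  exists (cnf_and (cnf_or x1 x2) z); last first.
    by move=> a; rewrite eval_cnf_and eval_cnf_or e1 e2 ez.
  exists (scope (X true), scope (X false)) => //.
  by exists (cnf_or x1 x2); [exists x1 => //; exists x2|exists z].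
have lower z : (\bigcup_(h in two_partitions L)
       set_and (set_or (graph_cnfs h.1) (graph_cnfs h.2)) (graph_cnfs r)) z ->
    exists X y, split_realizes L r X y /\
    forall a, eval_cnf a z
              = (eval_cnf a (X true) || eval_cnf a (X false)) && eval_cnf a y.
  move=> [[h1 h2] /= hL [_ [x1 g1 [x2 g2 <-]] [y gy <-]]].
  have [y1 [w1 s1] e1] := realize_graph_cnf g1.
  have [y2 [w2 s2] e2] := realize_graph_cnf g2.
  have [z' rz ez] := realize_graph_cnf gy.
  exists (fun b => if b then y1 else y2), z'; split.
    by split=> [[]||] //; rewrite s1 s2.
  by move=> a; rewrite eval_cnf_and eval_cnf_or e1 e2 ez.
split=> -[[x hx] sat]; split.
- by have [X [y [s _]]] := lower _ hx; exists X, y.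
- by move=> X y /lift[z /sat[a az] ez]; exists a; rewrite -ez.
- by have [y s] := hx; have [z hz _] := lift _ _ s; exists z.
- by move=> z /lower[X [y [/sat[a az] ez]]]; exists a; rewrite ez.
Qed.

Lemma equisat_partitions g v :
  equisat (graph_cnfs g)
    (\bigcup_(h in two_partitions (punctured_star g v))
       set_and (set_or (graph_cnfs h.1) (graph_cnfs h.2))
               (graph_cnfs (rest g v))).
Proof.
by rewrite /equisat totally_satisfiable_partitions; exact: eliminate_vertex.
Qed.

(** * Vertices of degree one *)

Lemma degree1_star g v : degree g v = 1 ->
  exists e, punctured_star g v = [mset e]%mset.
Proof.
move=> d1.
have [f [fg vf]] : exists f, f \in g /\ v \in f.
  apply/not_existsP => no; move: d1; rewrite /degree big_seq_cond big1 // => e.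
  by rewrite msuppE => /andP[eg ve]; case: (no e).
exists (f `\ v)%fset; apply/msetP => e; rewrite punctured_starE msetnE.
move: d1; rewrite /degree -big_filter (bigD1_seq f) /=; first last.
- exact/filter_uniq/fset_uniq.
- by rewrite mem_filter vf msuppE.
rewrite big_filter_cond => d1.
have gf : g f = 1.
  by apply/eqP; rewrite eqn_leq mset_gt0 fg andbT -d1 leq_addr.
move/eqP: d1; rewrite gf -[X in _ == X]addn0 eqn_add2l sum_nat_seq_eq0.
move=> /allP other; case: ifP => ve.
  by case: eqP => // ef; rewrite ef !inE eqxx in ve.
case: eqP => [->|ef]; first by rewrite fsetD1K.
apply/eqP; apply: contraT; rewrite -lt0n mset_gt0 -msuppE => eg.
have := other _ eg; rewrite !inE eqxx /=.
case: eqP => [fe|_ /= /eqP e0]; last by rewrite msuppE -mset_gt0 e0 in eg.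
by case: ef; rewrite -fe fsetU1K ?ve.
Qed.

(** In a 2-partition of a single edge one part is empty; the Cnf on it is the
empty conjunction, which makes the disjunction true. *)
Lemma split_satisfiable1 e r :
  split_satisfiable [mset e]%mset r <-> totally_satisfiable (graph_cnfs r).
Proof.
rewrite totally_satisfiable_realizes.
have s1 y : realizes r y -> exists X, split_realizes [mset e]%mset r X y.
  move=> ry.
  exists (fun b => if b then [fset signed xpredT e]%fset else fset0).
  split=> // [[]|]; first 2 last.
  - apply/msetP => f; rewrite msetE2 !scopeE big_seq_fset1 big_nil addn0.
    by rewrite vars_signed msetnE eq_sym; case: eqP.
  - by apply: signed_cnfI => c; rewrite inE => /eqP ->; exists xpredT, e.
  - by move=> c; rewrite inE.
split=> -[[x hx] sat]; split.
- by have [y [_ ry _]] := hx; exists y.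
- by move=> y /s1[X /sat[a /andP[_ ay]]]; exists a.
- by have [X sX] := s1 x hx; exists X, x.
move=> X y [wX ry sX]; have [a ay] := sat y ry; exists a; rewrite ay andbT.
have empty b : scope (X b) e = 0 -> X b = fset0.
  move=> se; apply/realizes0; split; first exact: wX.
  apply/msetP => f; rewrite mset0E; case: (eqVneq f e) => [-> //|fe].
  have := congr1 (fun m : {mset edge V} => m f) sX.
  rewrite /= msetE2 msetnE (negbTE fe) => /eqP; rewrite addn_eq0.
  by case: b {se} => /andP[/eqP ? /eqP].
have := congr1 (fun m : {mset edge V} => m e) sX.
rewrite /= msetE2 msetnxx; case st: (scope (X true) e) => [|n].
  by rewrite (empty true) // eval_cnf0.
rewrite addSn => -[] /eqP; rewrite addn_eq0 => /andP[_ /eqP /empty ->].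
by rewrite eval_cnf0 orbT.
Qed.

Lemma equisat_rest g v :
  degree g v = 1 -> equisat (graph_cnfs g) (graph_cnfs (rest g v)).
Proof.
move=> /degree1_star[e se]; rewrite /equisat (eliminate_vertex g v) se.
exact: split_satisfiable1.
Qed.

End SignedClauses.

Theorem theorem3p5 (V : countType) (g : {mset edge V}) (v : V)
    (hg : is_graph g) (hv : exists2 e, e \in g & v \in e) :
  [/\ (2 <= degree g v)%N -> [fset v]%fset \notin g ->
        equisat (graph_cnfs g)
          (\bigcup_(h in two_partitions (link g v))
             set_and (set_or (graph_cnfs h.1) (graph_cnfs h.2))
                     (graph_cnfs (rest g v))),
      (2 <= degree g v)%N -> [fset v]%fset \in g ->
        equisat (graph_cnfs g)
          (\bigcup_(h in two_partitions (punctured_star g v))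
             set_and (set_or (graph_cnfs h.1) (graph_cnfs h.2))
                     (graph_cnfs (rest g v)))
    & degree g v = 1%N ->
        equisat (graph_cnfs g) (graph_cnfs (rest g v))].
Proof.
split=> [_ no_loop|_ _|]; last exact: equisat_rest.
  by rewrite link_no_loop //; exact: equisat_partitions.
exact: equisat_partitions.
Qed.
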